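(* Let $\Gamma \subset \operatorname{Aut}(\mathbb{C}^n)$ be a discrete group of automorphisms acting freely and properly discontinuously on $\mathbb{C}^n$. Suppose $\sigma : \mathbb{C}^n \times \mathbb{C}^n \to \mathbb{C}^n$ is a holomorphic map such that for each $z \in \mathbb{C}^n$ we have $\sigma_z = \sigma(z,\cdot) \in \operatorname{Aut}(\mathbb{C}^n)$ and $\sigma_z(0) = z$, and suppose $\lambda : \Gamma \to \operatorname{GL}(n,\mathbb{C})$, $\gamma \mapsto \lambda_\gamma$, is a group homomorphism. If for all $z \in \mathbb{C}^n$ and all $\gamma \in \Gamma$ we have $\sigma_{\gamma(z)} \circ \lambda_\gamma \circ \sigma_z^{-1} = \gamma$, then $\mathbb{C}^n/\Gamma$ is an elliptic manifold.
   Context: $\operatorname{Aut}(\mathbb{C}^n)$ is the group of holomorphic automorphisms of $\mathbb{C}^n$. Elements of $\operatorname{GL}(n,\mathbb{C})$ are regarded as linear automorphisms of $\mathbb{C}^n$. Since $\Gamma$ acts freely and properly discontinuously, $\mathbb{C}^n/\Gamma$ is a complex $n$-manifold and the quotient map $\mathbb{C}^n \to \mathbb{C}^n/\Gamma$ is a holomorphic covering map. A complex manifold $M$ is elliptic if there exist a holomorphic vector bundle $E \to M$ and a holomorphic map $s : E \to M$ (called a dominating spray) such that, for all $x \in M$, $s(0_x) = x$ and the restriction $s|_{E_x} : E_x \to M$ to the fibre $E_x$ is a submersion at $0_x$, where $0_x$ is the zero vector of $E_x$. *)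

(* Defs.v *)
From HB Require Import structures.
From mathcomp Require Import all_boot all_order all_algebra.
From mathcomp Require Import generic_quotient.
From mathcomp Require Import complex.
From mathcomp Require Import all_classical all_reals all_analysis.

Set Implicit Arguments.
Unset Strict Implicit.
Unset Printing Implicit Defensive.

Import Order.TTheory GRing.Theory Num.Theory.
Import numFieldNormedType.Exports.

Local Open Scope classical_set_scope.
Local Open Scope ring_scope.

(* R[i] with the topology and norm of a numFieldType, which only abstract
   structures receive from numFieldNormedType. *)
Definition C (R : realType) : Type := R[i].
HB.instance Definition _ (R : realType) := Num.ClosedField.on (C R).
#[non_forgetful_inheritance]
HB.instance Definition _ (R : realType) := GRing.ComAlgebra.copy (C R) (C R)^o.
#[non_forgetful_inheritance]
HB.instance Definition _ (R : realType) := Vector.copy (C R) (C R)^o.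
#[non_forgetful_inheritance]
HB.instance Definition _ (R : realType) := NormedModule.copy (C R) (C R)^o.

(* A map between finite-dimensional complex spaces is holomorphic when it is
   Frechet differentiable over C at every point. *)
Definition holomorphic (R : realType) (V W : normedModType (C R)) (f : V -> W) :=
  forall z : V, differentiable f z.

Record aut (R : realType) (n : nat) := Aut {
  aut_fun :> 'cV[C R]_n -> 'cV[C R]_n;
  aut_finv : 'cV[C R]_n -> 'cV[C R]_n;
  aut_funK : cancel aut_fun aut_finv;
  aut_finvK : cancel aut_finv aut_fun;
  aut_holo : holomorphic aut_fun;
  aut_finv_holo : holomorphic aut_finv }.

Section AutGroup.
Variables (R : realType) (n : nat).
Local Notation aut := (aut R n).

Lemma aut_eqP (f g : aut) : f =1 g -> f = g.
Proof.
case: f => f f' fK f'K hf hf'; case: g => g g' gK g'K hg hg' /= /funext fg.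
subst g; have /funext e : f' =1 g' by move=> z; rewrite -[in LHS](g'K z) fK.
subst g'; congr Aut; exact: Prop_irrelevance.
Qed.

HB.instance Definition _ := gen_eqMixin aut.
HB.instance Definition _ := gen_choiceMixin aut.

Lemma holomorphic_id : holomorphic (@id 'cV[C R]_n).
Proof. by move=> z; exact: ex_diff. Qed.

Lemma holomorphic_comp (f g : 'cV[C R]_n -> 'cV[C R]_n) :
  holomorphic f -> holomorphic g -> holomorphic (f \o g).
Proof. by move=> hf hg z; exact: differentiable_comp. Qed.

Definition aut_one : aut :=
  Aut (fun=> erefl) (fun=> erefl) holomorphic_id holomorphic_id.

Definition aut_mul (f g : aut) : aut :=
  Aut (can_comp (aut_funK f) (aut_funK g))
      (can_comp (aut_finvK g) (aut_finvK f))
      (holomorphic_comp (aut_holo f) (aut_holo g))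
      (holomorphic_comp (aut_finv_holo g) (aut_finv_holo f)).

Definition aut_inv (f : aut) : aut :=
  Aut (aut_finvK f) (aut_funK f) (aut_finv_holo f) (aut_holo f).

Fact aut_mulA : associative aut_mul.
Proof. by move=> f g h; exact: aut_eqP. Qed.
Fact aut_mul1 : left_id aut_one aut_mul.
Proof. by move=> f; exact: aut_eqP. Qed.
Fact aut_mulr1 : right_id aut_one aut_mul.
Proof. by move=> f; exact: aut_eqP. Qed.
Fact aut_mulV : left_inverse aut_one aut_inv aut_mul.
Proof. by move=> f; apply: aut_eqP => z /=; rewrite aut_funK. Qed.
Fact aut_mulrV : right_inverse aut_one aut_inv aut_mul.
Proof. by move=> f; apply: aut_eqP => z /=; rewrite aut_finvK. Qed.

HB.instance Definition _ :=
  isGroup.Build aut aut_mulA aut_mul1 aut_mulr1 aut_mulV aut_mulrV.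

End AutGroup.

HB.instance Definition _ (R : realType) (n : nat) :=
  Topological.copy (aut R n)
    (initial_topology (@aut_fun R n :
       aut R n -> {compact-open, 'cV[C R]_n -> 'cV[C R]_n})).

Definition discrete_subset (T : topologicalType) (A : set T) :=
  A `<=` isolated A.

Section Action.
Variables (R : realType) (n : nat).

Definition acts_freely (G : {pred aut R n}) :=
  forall g z, g \in G -> g z = z -> g = 1%g.

(* The version of proper discontinuity with compact sets, so that orbit spaces
   are Hausdorff. *)
Definition acts_properly_discontinuously (G : {pred aut R n}) :=
  forall K : set 'cV[C R]_n, compact K ->
    finite_set [set g : aut R n | g \in G /\ (g @` K) `&` K !=set0].

Variable G : groupClosed (aut R n).

Definition orbit_rel : rel 'cV[C R]_n :=
  fun z w => `[< exists2 g : aut R n, g \in G & g z = w >].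

Lemma orbit_relP : equiv_class_of orbit_rel.
Proof.
split=> [z|z w|w z v].
- by apply/asboolP; exists 1%g => //; exact: gpred1.
- apply/asboolP/asboolP => -[g gG <-]; exists g^-1%g; rewrite ?gpredV //;
  exact: aut_funK.
- move=> /asboolP[g gG <-] /asboolP[h hG <-]; apply/asboolP.
  by exists (h * g)%g => //; exact: gpredM.
Qed.

Definition orbit_equiv : equiv_rel 'cV[C R]_n := EquivRelPack orbit_relP.

Definition orbit_space : topologicalType :=
  quotient_topology {eq_quot orbit_equiv}%qT.

Definition orbit_proj : 'cV[C R]_n -> orbit_space :=
  (\pi_(quotient_topology {eq_quot orbit_equiv}))%qT.

End Action.

(* Atlases below are sets of charts, not required to be maximal.
   [chart_inv] is only meaningful on the image of [chart_dom]. *)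
Record chart (R : realType) (n : nat) (M : Type) := Chart {
  chart_dom : set M;
  chart_map : M -> 'cV[C R]_n;
  chart_inv : 'cV[C R]_n -> M }.

Section Manifolds.
Variable R : realType.

Definition chart_img n (M : Type) (c : chart R n M) : set 'cV[C R]_n :=
  chart_map c @` chart_dom c.

Definition is_chart n (M : topologicalType) (c : chart R n M) :=
  [/\ open (chart_dom c), open (chart_img c),
      {within chart_dom c, continuous (chart_map c)},
      {within chart_img c, continuous (chart_inv c)} &
      {in chart_dom c, cancel (chart_map c) (chart_inv c)}].

Definition complex_manifold n (M : topologicalType)
    (A : set (chart R n M)) :=
  [/\ hausdorff_space M, @second_countable M,
      (forall c, A c -> is_chart c),
      (forall x : M, exists2 c, A c & chart_dom c x) &
      forall c d x, A c -> A d -> chart_dom c x -> chart_dom d x ->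
        differentiable (chart_map d \o chart_inv c) (chart_map c x)].

Definition holomorphic_on m n (M N : topologicalType)
    (A : set (chart R m M)) (B : set (chart R n N)) (D : set M) (f : M -> N) :=
  [/\ open D, {within D, continuous f} &
      forall c d x, A c -> B d -> D x -> chart_dom c x -> chart_dom d (f x) ->
        differentiable (chart_map d \o f \o chart_inv c) (chart_map c x)].

Definition submersion_at m n (M N : Type)
    (A : set (chart R m M)) (B : set (chart R n N)) (f : M -> N) (x : M) :=
  forall c d, A c -> B d -> chart_dom c x -> chart_dom d (f x) ->
    let g := chart_map d \o f \o chart_inv c in
    differentiable g (chart_map c x) /\
    range ('d g (chart_map c x) : 'cV[C R]_m -> 'cV[C R]_n) = [set: 'cV[C R]_n].

Definition std_atlas n : set (chart R n 'cV[C R]_n) :=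
  [set Chart [set: 'cV[C R]_n] id id].

Definition prod_chart m n (M N : Type) (c : chart R m M) (d : chart R n N) :
    chart R (m + n) (M * N) :=
  Chart (chart_dom c `*` chart_dom d)
    (fun p => col_mx (chart_map c p.1) (chart_map d p.2))
    (fun v => (chart_inv c (usubmx v), chart_inv d (dsubmx v))).

Definition prod_atlas m n (M N : Type)
    (A : set (chart R m M)) (B : set (chart R n N)) :
    set (chart R (m + n) (M * N)) :=
  [set prod_chart c d | c in A & d in B].

(* The complex structure of an r-dimensional vector space: its charts are the
   linear isomorphisms to C^r. *)
Definition linear_atlas r (V : lmodType (C R)) : set (chart R r V) :=
  [set c | [/\ chart_dom c = [set: V], linear (chart_map c),
    cancel (chart_map c) (chart_inv c) & cancel (chart_inv c) (chart_map c)]].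

(* The fibre over [x] is a vector space [vb_fibre x], identified by [vb_incl x]
   with the preimage of [x] in the total space. In [vb_local_triv], the map
   [theta] is the inverse of the trivialisation e |-> (vb_proj e, tau e). *)
Record vector_bundle n (M : topologicalType) (A : set (chart R n M))
    (r : nat) := VectorBundle {
  vb_total : topologicalType;
  vb_atlas : set (chart R (n + r) vb_total);
  vb_manifold : complex_manifold vb_atlas;
  vb_proj : vb_total -> M;
  vb_proj_holo : holomorphic_on vb_atlas A setT vb_proj;
  vb_fibre : M -> lmodType (C R);
  vb_incl : forall x : M, vb_fibre x -> vb_total;
  vb_incl_inj : forall x, injective (@vb_incl x);
  vb_incl_range : forall x, range (@vb_incl x) = vb_proj @^-1` [set x];
  vb_local_triv : forall x0 : M, exists U : set M,
    exists (tau : vb_total -> 'cV[C R]_r) (theta : M * 'cV[C R]_r -> vb_total),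
    let triv e := (vb_proj e, tau e) in
    [/\ open U /\ U x0,
        holomorphic_on vb_atlas (prod_atlas A (@std_atlas r))
          (vb_proj @^-1` U) triv,
        holomorphic_on (prod_atlas A (@std_atlas r)) vb_atlas
          (U `*` setT) theta,
        {in vb_proj @^-1` U, cancel triv theta} /\
        {in U `*` setT, cancel theta triv} &
        forall x, U x -> linear (tau \o @vb_incl x)] }.

Arguments vb_atlas {n M A r} _ _.
Arguments vb_incl {n M A r} _ x _.

Definition dominating_spray n (M : topologicalType) (A : set (chart R n M))
    r (E : vector_bundle A r) (s : vb_total E -> M) :=
  holomorphic_on (vb_atlas E) A setT s /\
  forall x : M, s (vb_incl E x 0) = x /\
    submersion_at (@linear_atlas r (vb_fibre E x)) A
      (s \o vb_incl E x) 0.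

Definition elliptic_manifold n (M : topologicalType)
    (A : set (chart R n M)) :=
  complex_manifold A /\
  exists r (E : vector_bundle A r) (s : vb_total E -> M), dominating_spray s.

End Manifolds.

(* The charts of the quotient are the inverses of the homeomorphic restrictions
   of the projection to open sets. *)
Definition orbit_atlas (R : realType) (n : nat) (G : groupClosed (aut R n)) :
    set (chart R n (orbit_space G)) :=
  [set c | is_chart c /\ {in chart_img c, chart_inv c =1 orbit_proj G}].
Arguments orbit_atlas {R n} G _.

(* Main.v *)
Require Import Defs.
From HB Require Import structures.
From mathcomp Require Import all_boot all_order all_algebra.
From mathcomp Require Import generic_quotient.
From mathcomp Require Import complex.
From mathcomp Require Import all_classical all_reals all_analysis.
Import Order.TTheory GRing.Theory Num.Theory.
Import numFieldNormedType.Exports.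
Local Open Scope classical_set_scope.
Local Open Scope ring_scope.

Set Implicit Arguments.
Unset Strict Implicit.

(** The spray on the quotient is induced by [sigma] from the associated flat
    bundle. Let [Gamma] act on C^n x C^n by [g (z, v) = (g z, lambda_g v)]. The
    quotient E of this action is a flat vector bundle over C^n/Gamma, and the
    hypothesis on [sigma] reads [sigma_(g z) (lambda_g v) = g (sigma_z v)]: the
    map [(z, v) |-> sigma_z v] is equivariant, so it descends to a holomorphic
    map [s : E -> C^n/Gamma]. On the zero section, [s] is the identity since
    [sigma_z 0 = z]; on the fibre over the orbit of [z], it is the automorphism
    [sigma_z] followed by the quotient map, which is a local biholomorphism.
    Hence it is a submersion.

    The lifted transformations [(g, lambda_g)] form a group of automorphisms of
    C^(n + n) ([lift_group]) which again acts freely and properly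
    discontinuously, so that the same theorem on quotients
    ([orbit_space_manifold]) makes both the base and the total space complex
    manifolds, and the same criterion ([equivariant_holomorphic_on]) makes both
    the bundle projection and the spray holomorphic.

    Everything about quotients rests on two facts. The projection is an open
    map, so topological properties of the quotient can be tested upstairs. And
    near any point, a chart of the quotient composed with the projection
    coincides with a single element of the group ([orbit_chart_proj_near]), so
    that any map expressed in charts becomes a map of C^n composed with
    automorphisms. The hypothesis that compact sets meet only finitely many of
    their translates is turned into separation of orbits
    ([orbit_separation]), from which both the Hausdorff property and the
    existence of evenly covered open sets follow. *)

(** * Open maps and countable bases *)

Definition open_map (S T : topologicalType) (f : S -> T) :=
  forall U : set S, open U -> open (f @` U).

Lemma open_map_near (S T : topologicalType) (f : S -> T) (P : set T) x :
  open_map f -> (\forall z \near x, P (f z)) -> \forall y \near f x, P y.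
Proof.
move=> fo; rewrite /prop_near1 !nbhsE => -[U [oU Ux] UP].
exists (f @` U); first by split; [exact: fo|exists x].
by move=> _ [z Uz <-]; exact: UP.
Qed.

Lemma open_map_continuous_at (S T Z : topologicalType) (f : S -> T)
    (h : T -> Z) x :
  open_map f -> {for x, continuous (h \o f)} -> {for f x, continuous h}.
Proof. by move=> fo hf W /hf; exact: open_map_near. Qed.

(** This transports a countable basis both from R^2n to C^n and from C^n to its
    quotients. *)
Lemma second_countable_image (S T : topologicalType) (f : S -> T) :
  continuous f -> open_map f -> (forall y, exists x, f x = y) ->
  @second_countable S -> @second_countable T.
Proof.
move=> cf fo sf [B cB [Bo Bb]]; exists [set f @` b | b in B].
  exact: card_le_trans (card_image_le _ _) cB.
split=> [_ [b /Bo/fo ofb <-] //|y U]; have [x <-] := sf y.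
move=> /cf /Bb[b [Bb' bx] bU]; exists (f @` b).
  by split; [exists b|exists x].
by move=> _ [z /bU ? <-].
Qed.

(** The topology of matrices is entrywise, so the boxes whose sides belong to a
    countable basis of [T] form a basis. There are countably many of them, since
    a box is a function from the finite set of positions to a countable set. *)
Lemma second_countable_mx (T : topologicalType) m n :
  @second_countable T -> @second_countable 'M[T]_(m, n).
Proof.
move=> [B cB [Bo Bb]].
pose box (b : 'I_m -> 'I_n -> set T) : set 'M[T]_(m, n) :=
  [set M | forall i j, b i j (M i j)].
have [e eB] : exists e : set T -> nat, {in B &, injective e}.
  exact/countable_injP.
pose bs := [set b : 'I_m -> 'I_n -> set T | forall i j, B (b i j)].
exists [set box b | b in bs].
  (* Numbering the basis by [e] embeds the boxes into a countable type. *)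
  apply: (card_le_trans (card_image_le _ _)).
  pose code (b : 'I_m -> 'I_n -> set T) : {ffun 'I_m * 'I_n -> nat} :=
    [ffun ij => e (b ij.1 ij.2)].
  have : {in bs &, injective code}.
    move=> b b' /set_mem hb /set_mem hb' /ffunP E.
    apply/funext => i; apply/funext => j; apply: eB; rewrite ?inE //.
    by have := E (i, j); rewrite !ffunE.
  move=> /inj_card_eq E; apply: (card_le_trans _ (countableP (code @` bs))).
  by have := E; rewrite card_eq_le => /andP[].
split.
  move=> _ [b hb <-]; rewrite openE => M bM; exists b => // i j.
  exact: open_nbhs_nbhs (conj (Bo _ (hb i j)) (bM i j)).
move=> M U [P MP PU].
have /choice[b hb] : forall ij : 'I_m * 'I_n, exists b : set T,
    [/\ B b, b (M ij.1 ij.2) & b `<=` P ij.1 ij.2].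
  by move=> [i j]; have [b [? ?] ?] := Bb _ _ (MP i j); exists b.
exists (box (fun i j => b (i, j))).
  split; last by move=> i j; have [] := hb (i, j).
  by exists (fun i j => b (i, j)) => // i j; have [] := hb (i, j).
by move=> N bN; apply: PU => i j; have [_ _] := hb (i, j); apply; exact: bN.
Qed.

Lemma second_countable_real (R : realType) : @second_countable R.
Proof.
pose I (q : rat * rat) : set R := `]ratr q.1, ratr q.2[%classic.
exists (range I).
  exact: card_le_trans (card_image_le _ _) (countableP _).
split=> [_ [q _ <-]|x U]; first exact: interval_open.
rewrite -nbhs_ballE => -[e /= e0 xU].
have [p /andP[]] : exists q : rat, x - e < ratr q < x.
  have /rat_in_itvoo[q] : x - e < x by rewrite ltrBlDr ltrDl.
  by exists q.
have [q /andP[]] : exists q : rat, x < ratr q < x + e.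
  have /rat_in_itvoo[q] : x < x + e by rewrite ltrDl.
  by exists q.
move=> xq qe ep px; exists (I (p, q)).
  by split; [exists (p, q)|rewrite /I /= in_itv /= px].
move=> y; rewrite /I /= in_itv /= => /andP[py yq]; apply: xU.
by rewrite /ball /= ltr_distlC (lt_trans ep py) (lt_trans yq qe).
Qed.

Lemma continuous_mx (S T : topologicalType) m n (f : S -> 'M[T]_(m, n)) x :
  (forall i j, {for x, continuous (fun s => f s i j)}) -> {for x, continuous f}.
Proof.
move=> cf U [P fP PU]; apply: (@filterS _ (nbhs x) _
  [set s | forall i j, P i j (f s i j)]); first by move=> s; exact: PU.
apply: filter_forall => i; apply: filter_forall => j; exact: cf (fP i j).
Qed.

(** * Differentiability: local nature, linear maps, matrices *)

(** Being differentiable at a point is a local condition. Maps read in charts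
    are known explicitly only near a point, and this is how their
    differentials are computed. *)
Lemma near_eq_is_diff (K : numFieldType) (V W : normedModType K)
    (f g df : V -> W) x :
  (\forall y \near x, f y = g y) -> is_diff x f df -> is_diff x g df.
Proof.
move=> fg [dfx <-]; have [cdf /eqaddoP fE] := (diff_locallyP _ _).1 dfx.
have gE : g \o shift x = cst (g x) + 'd f x +o_ 0 id.
  apply/eqaddoP => e e0; move: (fE e e0) fg => + fg.
  rewrite -(nbhs_singleton fg).
  have fg0 : \forall h \near 0, f (h + x) = g (h + x).
    by move: fg; rewrite (near_shift 0 x) /= subr0.
  move=> fE'; near=> h; rewrite /= !fctE /=.
  by have <- : f (h + x) = g (h + x); near: h.
have dgx : 'd g x = 'd f x :> (V -> W) by exact: diff_unique.
split; last exact: dgx.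
by apply/diff_locallyP; rewrite dgx.
Unshelve. all: by end_near. Qed.

Lemma near_eq_differentiable (K : numFieldType) (V W : normedModType K)
    (f g : V -> W) x :
  (\forall y \near x, f y = g y) -> differentiable f x -> differentiable g x.
Proof. by move=> fg /differentiableP /(near_eq_is_diff fg)[]. Qed.

Section MatrixCalculus.
Variable K : numFieldType.

(** Holomorphy of every linear map below reduces to that of the coordinates,
    because a linear map out of a matrix space is a finite combination of
    them. *)
Lemma mx_linear_differentiable m n (V : normedModType K)
    (f : 'M[K]_(m, n) -> V) A :
  linear f -> differentiable f A.
Proof.
move=> lf.
pose fL : {linear _ -> _} := HB.pack f (GRing.isLinear.Build _ _ _ _ _ lf).
have -> : f = \sum_i \sum_j (fun B : 'M[K]_(m, n) => B i j *: f (delta_mx i j)).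
  apply/funext => B; rewrite -[f in LHS]/(fL : _ -> _).
  rewrite [in LHS](matrix_sum_delta B) linear_sum.
  rewrite fct_sumE; apply: eq_bigr => i _; rewrite linear_sum fct_sumE.
  by apply: eq_bigr => j _; rewrite linearZ.
do 2![apply: differentiable_sum => ?]; apply: differentiableZl.
exact: differentiable_coord.
Qed.

Lemma differentiable_usubmx m1 m2 n (A : 'M[K]_(m1 + m2, n)) :
  differentiable (@usubmx K m1 m2 n) A.
Proof. by apply: mx_linear_differentiable => a u v; rewrite linearP. Qed.

Lemma differentiable_dsubmx m1 m2 n (A : 'M[K]_(m1 + m2, n)) :
  differentiable (@dsubmx K m1 m2 n) A.
Proof. by apply: mx_linear_differentiable => a u v; rewrite linearP. Qed.

Lemma differentiable_mulmx m n p (M : 'M[K]_(m, n)) (A : 'M[K]_(n, p)) :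
  differentiable (mulmx M) A.
Proof. by apply: mx_linear_differentiable => a u v; rewrite linearP. Qed.

Lemma continuous_col_mx m1 m2 n (T : topologicalType)
    (f : T -> 'M[K]_(m1, n)) (g : T -> 'M[K]_(m2, n)) x :
  {for x, continuous f} -> {for x, continuous g} ->
  {for x, continuous (fun y => col_mx (f y) (g y))}.
Proof.
move=> cf cg; apply: continuous_mx => i j; case: (split_ordP i) => k ->.
  rewrite (_ : (fun _ => _) = (fun A : 'M[K]_(m1, n) => A k j) \o f); last first.
    by apply/funext => y; rewrite col_mxEu.
  by apply: continuous_comp => //; exact: coord_continuous.
rewrite (_ : (fun _ => _) = (fun A : 'M[K]_(m2, n) => A k j) \o g); last first.
  by apply/funext => y; rewrite col_mxEd.
by apply: continuous_comp => //; exact: coord_continuous.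
Qed.

Lemma differentiable_col_mx m1 m2 n (V : normedModType K)
    (f : V -> 'M[K]_(m1, n)) (g : V -> 'M[K]_(m2, n)) x :
  differentiable f x -> differentiable g x ->
  differentiable (fun y => col_mx (f y) (g y)) x.
Proof.
move=> df dg.
have -> : (fun y => col_mx (f y) (g y)) =
    ((fun A => col_mx A (0 : 'M[K]_(m2, n))) \o f) +
    ((fun A => col_mx (0 : 'M[K]_(m1, n)) A) \o g).
  by apply/funext => y; rewrite fctE /= add_col_mx addr0 add0r.
apply: differentiableD; apply: differentiable_comp => //;
apply: mx_linear_differentiable => a u v;
by rewrite scale_col_mx add_col_mx scaler0 addr0.
Qed.

(** The chain rule for [f \o k = id] makes ['d k] a right inverse of ['d f]. *)
Lemma diff_right_inverse_surj (V W : normedModType K) (f : V -> W) (k : W -> V) y :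
  cancel k f -> differentiable k y -> differentiable f (k y) ->
  range ('d f (k y) : V -> W) = [set: W].
Proof.
move=> kK dk df; apply/seteqP; split=> // w _.
exists ('d k y w) => //; have := diff_comp dk df.
have -> : f \o k = id by exact/funext.
rewrite (@diff_lin _ _ _ idfun); last by move=> ?.
by move=> /(congr1 (fun h : W -> W => h w)).
Qed.

End MatrixCalculus.

(** * The topology of C^n *)

Lemma continuous_Re (R : realType) : continuous (fun z : C R => complex.Re z).
Proof.
move=> z U /nbhs_ballP[e e0 eU]; apply/nbhs_ballP.
exists (e%:C)%C; first by rewrite /= ltcR.
move=> w; rewrite -ball_normE /ball_ /= => zw; apply: eU.
rewrite -ball_normE /ball_ /= -ltcR; apply: le_lt_trans zw.
have := normc_ge_Re ((z : R[i]) - w).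
by rewrite raddfB.
Qed.

Lemma continuous_Im (R : realType) : continuous (fun z : C R => complex.Im z).
Proof.
have -> : (fun z : C R => complex.Im z) =
    fun z => - complex.Re ((z : C R) * ('i%C : C R)).
  by apply/funext => z; rewrite ReiNIm opprK.
move=> z; have mi : {for z, continuous (fun z : C R => z * ('i%C : C R))}.
  exact: mulrr_continuous.
exact: (cvgN (continuous_comp mi (@continuous_Re R _))).
Qed.

Lemma continuous_real_complex (R : realType) :
  continuous (fun x : R => (x%:C)%C : C R).
Proof.
move=> x U /nbhs_ballP[[e e'] /=]; rewrite ltcE /= => /andP[/eqP e'0 e0 eU].
apply/nbhs_ballP; exists e => // y.
rewrite -ball_normE /ball_ /= => xy; apply: eU.
rewrite -ball_normE /ball_ /= e'0.
have -> : ((x%:C)%C : C R) - (y%:C)%C = ((x - y)%:C)%C by rewrite raddfB.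
by rewrite [X in X < _](normc_def ((x - y)%:C)%C) /= expr0n addr0 sqrtr_sqr ltcR.
Qed.

Section ComplexSpace.
Variables (R : realType) (n : nat).

(** C^n is homeomorphic to R^2n by real and imaginary parts. Local compactness
    and the countable basis of C^n are those of R^2n. *)
Definition of_real_coords (v : 'rV[R]_(n + n)) : 'cV[C R]_n :=
  \col_i (v 0 (lshift n i) +i* v 0 (rshift n i))%C.

Definition real_coords (z : 'cV[C R]_n) : 'rV[R]_(n + n) :=
  row_mx (\row_j complex.Re (z j 0)) (\row_j complex.Im (z j 0)).

Lemma of_real_coordsK : cancel of_real_coords real_coords.
Proof.
move=> v; rewrite -[RHS]hsubmxK; congr row_mx; apply/rowP => j;
by rewrite !mxE.
Qed.

Lemma real_coordsK : cancel real_coords of_real_coords.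
Proof.
move=> z; apply/colP => i; rewrite mxE /real_coords row_mxEl row_mxEr !mxE.
by case: (z i 0).
Qed.

Lemma continuous_of_real_coords : continuous of_real_coords.
Proof.
move=> v; apply: continuous_mx => i j.
have -> : (fun s => of_real_coords s i j) = (fun s : 'rV[R]_(n + n) =>
    ((s 0 (lshift n i))%:C%C : C R) + ('i%C : C R) * (s 0 (rshift n i))%:C%C).
  by apply/funext => s; rewrite mxE [LHS]complexE.
have cR k : {for v, continuous (fun s : 'rV[R]_(n + n) => (s 0 k)%:C%C : C R)}.
  apply: (@continuous_comp _ _ _ (fun s : 'rV[R]_(n + n) => s 0 k)).
    exact: coord_continuous.
  exact: continuous_real_complex.
exact: (cvgD (cR _) (cvgM (cvg_cst _) (cR _))).
Qed.

Lemma continuous_real_coords : continuous real_coords.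
Proof.
move=> z; apply: continuous_mx => i j.
rewrite /real_coords; case: (split_ordP j) => k ->.
  have -> : (fun s : 'cV[C R]_n => row_mx (\row_j complex.Re (s j 0))
      (\row_j complex.Im (s j 0)) i (lshift n k)) =
      (fun x : C R => complex.Re x) \o (fun s : 'cV[C R]_n => s k 0).
    by apply/funext => s; rewrite row_mxEl mxE.
  apply: continuous_comp; [exact: coord_continuous|exact: continuous_Re].
have -> : (fun s : 'cV[C R]_n => row_mx (\row_j complex.Re (s j 0))
    (\row_j complex.Im (s j 0)) i (rshift n k)) =
    (fun x : C R => complex.Im x) \o (fun s : 'cV[C R]_n => s k 0).
  by apply/funext => s; rewrite row_mxEr mxE.
apply: continuous_comp; [exact: coord_continuous|exact: continuous_Im].
Qed.

Lemma open_map_of_real_coords : open_map of_real_coords.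
Proof.
move=> U oU; have -> : of_real_coords @` U = real_coords @^-1` U.
  apply/seteqP; split=> [_ [v Uv <-]|z Uz] /=; first by rewrite of_real_coordsK.
  by exists (real_coords z) => //; exact: real_coordsK.
by move/continuousP: continuous_real_coords; apply.
Qed.

Lemma second_countable_cV : @second_countable 'cV[C R]_n.
Proof.
apply: (second_countable_image continuous_of_real_coords).
- exact: open_map_of_real_coords.
- by move=> z; exists (real_coords z); exact: real_coordsK.
- exact/second_countable_mx/second_countable_real.
Qed.

(** The image of a closed cube of R^2n is a compact neighbourhood. *)
Lemma compact_nbhs_cV (z : 'cV[C R]_n) : exists2 K, compact K & nbhs z K.
Proof.
pose a := real_coords z.
pose I k : set R := `[a 0 k - 1, a 0 k + 1]%classic.
exists (of_real_coords @` [set v : 'rV[R]_(n + n) | forall k, I k (v 0 k)]).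
  apply: continuous_compact.
    exact/continuous_subspaceT/continuous_of_real_coords.
  by apply: rV_compact => k; exact: segment_compact.
rewrite -[z in nbhs z]real_coordsK; apply: (open_map_near open_map_of_real_coords).
have : nbhs a [set v : 'rV[R]_(n + n) | forall k, I k (v 0 k)].
  exists (fun _ k => I k).
    move=> i k; rewrite ord1; apply/nbhs_ballP; exists 1 => //= y.
    rewrite -ball_normE /ball_ /= /I /= in_itv /= ltr_distlC.
    by move=> /andP[/ltW -> /ltW ->].
  by move=> v /= vI k; exact: vI.
by apply: filterS => v vI; exists v.
Qed.

End ComplexSpace.

(** * Quotients by free, properly discontinuous actions *)

Lemma filter_bigI_finite_set (T : Type) (I : choiceType) (D : set I)
    (f : I -> set T) (F : set_system T) :
  Filter F -> finite_set D -> (forall i, F (f i)) -> F (\bigcap_(i in D) f i).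
Proof. by move=> FF /finite_fsetP[X ->] fF; apply: filter_bigI. Qed.

Section Orbits.
Variables (R : realType) (n : nat) (G : groupClosed (aut R n)).
Local Notation pi := (orbit_proj G).

Lemma holomorphic_continuous (V W : normedModType (C R)) (f : V -> W) :
  holomorphic f -> continuous f.
Proof. by move=> hf z; exact: differentiable_continuous. Qed.

Lemma aut_continuous (g : aut R n) : continuous g.
Proof. exact/holomorphic_continuous/aut_holo. Qed.

Lemma orbit_projP z w : pi z = pi w <-> exists2 g : aut R n, g \in G & g z = w.
Proof.
split=> [/eqmodP/asboolP //|zw].
by apply/eqmodP/asboolP.
Qed.

Lemma orbit_proj_act (g : aut R n) z : g \in G -> pi (g z) = pi z.
Proof. by move=> gG; apply/esym/orbit_projP; exists g. Qed.

Lemma orbit_proj_repr x : pi (repr x) = x.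
Proof. exact: reprK. Qed.

Lemma orbit_proj_continuous : continuous pi.
Proof. exact: pi_continuous. Qed.

(** The saturation of an open set is the union of its translates. Thanks to
    this, neighbourhoods and continuity in the quotient are tested on C^n. *)
Lemma orbit_proj_open : open_map pi.
Proof.
move=> U oU; rewrite /open /= /quotient_open openE => w [u Uu /orbit_projP[g gG guw]].
have : nbhs ((g^-1)%g w) U.
  apply: open_nbhs_nbhs; split=> //.
  by have -> : (g^-1)%g w = u by rewrite -guw; exact: aut_funK.
move=> /(@aut_continuous (g^-1)%g w); apply: (@filterS _ (nbhs w)) => v Uv /=.
by exists ((g^-1)%g v) => //; apply: orbit_proj_act; rewrite gpredV.
Qed.

Section ProperAction.
Hypothesis pdG : acts_properly_discontinuously G.

(** Only finitely many group elements carry a compact neighbourhood of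
    [z] and [w] to a set that meets it. Each of these finitely many [g] is
    handled separately, by separating [g z] from [w], and the intersection of
    the resulting neighbourhoods works for all of them. The predicate [P]
    allows two uses: with [P] always true, [z] and [w] in different orbits are
    separated in the quotient; with [z = w] and [P g] meaning [g <> 1], a free
    action has a neighbourhood of [z] disjoint from its translates. *)
Lemma orbit_separation (P : aut R n -> Prop) z w :
  (forall g, g \in G -> P g -> g z <> w) ->
  exists A B, [/\ nbhs z A, nbhs w B &
    forall (g : aut R n) a, g \in G -> P g -> A a -> ~ B (g a)].
Proof.
move=> Pzw; have [K1 cK1 zK1] := compact_nbhs_cV z.
have [K2 cK2 wK2] := compact_nbhs_cV w.
have /pdG := compactU cK1 cK2; set D := [set g | _] => finD.
have /choice[AB hAB] : forall g : aut R n, exists AB : set _ * set _,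
    [/\ nbhs z AB.1, nbhs w AB.2 &
      g \in G -> P g -> forall a, AB.1 a -> ~ AB.2 (g a)].
  move=> g; have [[gG Pg]|gP] := pselect (g \in G /\ P g); last first.
    by exists (setT, setT); split; [exact: filterT..|move=> gG Pg; case: gP].
  have /eqP gzw := Pzw g gG Pg.
  have := @norm_hausdorff _ 'cV[C R]_n; rewrite open_hausdorff => /(_ _ _ gzw).
  move=> [[A B] /= [/set_mem Agz /set_mem Bw] [oA oB /eqP AB0]].
  exists (g @^-1` A, B); split=> /=.
  - by apply: aut_continuous; exact: open_nbhs_nbhs.
  - exact: open_nbhs_nbhs.
  - by move=> _ _ a Aga Bga; have : (A `&` B) (g a) by []; rewrite AB0.
exists (K1 `&` \bigcap_(g in D) (AB g).1).
exists (K2 `&` \bigcap_(g in D) (AB g).2); split.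
- by apply: filterI => //; apply: filter_bigI_finite_set => // g; have [] := hAB g.
- by apply: filterI => //; apply: filter_bigI_finite_set => // g; have [] := hAB g.
- move=> g a gG Pg [K1a Aa] [K2ga Bga].
  have Dg : D g.
    split=> //; exists (g a); split; last by right.
    by exists a => //; left.
  have [_ _ /(_ gG Pg a)] := hAB g; apply; [exact: Aa|exact: Bga].
Qed.

Lemma orbit_space_hausdorff : hausdorff_space (orbit_space G).
Proof.
move=> x y; rewrite -(orbit_proj_repr x) -(orbit_proj_repr y).
move: (repr x) (repr y) => z w clzw; apply: contrapT => zw.
have [g gG _ gzw|A [B [zA wB AB]]] := @orbit_separation (fun=> True) z w.
  by apply: zw; apply/orbit_projP; exists g.
have imA u U : nbhs u U -> nbhs (pi u) (pi @` U).
  move=> uU; apply: (open_map_near orbit_proj_open).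
  by apply: filterS uU => a; exists a.
have [v [[a Aa <-] [b Bb ba]]] := clzw _ _ (imA _ _ zA) (imA _ _ wB).
have /orbit_projP[g gG gab] := esym ba.
by apply: (AB g a gG I Aa); rewrite gab.
Qed.

Lemma orbit_space_second_countable : @second_countable (orbit_space G).
Proof.
apply: (second_countable_image orbit_proj_continuous orbit_proj_open).
  by move=> x; exists (repr x); exact: orbit_proj_repr.
exact: second_countable_cV.
Qed.

End ProperAction.

Section Charts.
Implicit Type c : chart R n (orbit_space G).

(** A chart of the quotient is a local section of the projection: this lemma and
    the next one say so on the two sides. *)
Lemma orbit_chart_section c x :
  orbit_atlas G c -> chart_dom c x -> pi (chart_map c x) = x.
Proof.
move=> [[_ _ _ _ cK] cE] cx.
by rewrite -cE ?cK ?inE //; exists x.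
Qed.

Lemma orbit_chart_retract c w : orbit_atlas G c -> chart_img c w ->
  chart_dom c (pi w) /\ chart_map c (pi w) = w.
Proof. by move=> hc [x cx <-]; rewrite orbit_chart_section. Qed.

(** Both [z] and [chart_map c (pi z)] lie over the same point, hence differ by
    some [g]. For [w] near [z], the point [g w] stays in the image of
    the chart, where the chart inverts the projection. *)
Lemma orbit_chart_proj_near c z : orbit_atlas G c -> chart_dom c (pi z) ->
  exists2 g : aut R n, g \in G & g z = chart_map c (pi z) /\
    \forall w \near z, chart_dom c (pi w) /\ chart_map c (pi w) = g w.
Proof.
move=> hc cz; have [g gG gz] := (orbit_projP _ _).1 (esym (orbit_chart_section hc cz)).
exists g => //; split=> //.
have : nbhs (g z) (chart_img c).
  apply: open_nbhs_nbhs; split; first by have [[]] := hc.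
  by rewrite gz; exists (pi z).
move=> /(@aut_continuous g z); apply: (@filterS _ (nbhs z)) => w /=.
by move=> /(orbit_chart_retract hc); rewrite orbit_proj_act.
Qed.

Lemma orbit_chart_proj_differentiable c z : orbit_atlas G c ->
  chart_dom c (pi z) -> differentiable (chart_map c \o pi) z.
Proof.
move=> hc /(orbit_chart_proj_near hc)[g _ [_ gE]].
apply: near_eq_differentiable (aut_holo g z).
by apply: filterS gE => w [_ /= ->].
Qed.

Lemma orbit_chart_inv_near c z : orbit_atlas G c -> chart_img c z ->
  \forall w \near z, chart_inv c w = pi w.
Proof.
move=> [[_ oc _ _ _] cE] cz.
have : nbhs z (chart_img c) by exact: open_nbhs_nbhs.
by apply: filterS => w cw; apply: cE; rewrite inE.
Qed.

End Charts.

Section SmallCharts.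

(** The inverse of the projection restricted to [U], which is injective when
    [U] is evenly covered. *)
Definition quotient_chart (U : set 'cV[C R]_n) : chart R n (orbit_space G) :=
  Chart (pi @` U) (fun x => xget 0 (U `&` [set z | pi z = x])) pi.

Definition evenly_covered (U : set 'cV[C R]_n) :=
  open U /\ forall (g : aut R n) z, g \in G -> U z -> U (g z) -> g = 1%g.

Lemma evenly_covered_nbhs z : acts_freely G -> acts_properly_discontinuously G ->
  exists2 U, evenly_covered U & U z.
Proof.
move=> frG pdG.
have [g gG g1 /frG gz|A [B [zA zB AB]]] :=
    @orbit_separation pdG (fun g => g <> 1%g) z z.
  exact/g1/gz.
exists (A `&` B)°.
  split; first exact: open_interior.
  move=> g w gG /interior_subset[Aw _] /interior_subset[_ Bgw].
  by apply: contrapT => g1; apply: (AB g w).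
exact: filterI.
Qed.

Lemma quotient_chartK U z : evenly_covered U -> U z ->
  chart_map (quotient_chart U) (pi z) = z.
Proof.
move=> [oU hU] Uz /=; case: xgetP => [w _ [Uw /esym/orbit_projP[g gG gz]]|].
  by have g1 : g = 1%g by [apply: (hU g z gG); rewrite ?gz]; rewrite -gz g1.
by move=> /(_ z) []; split.
Qed.

Lemma quotient_chart_atlas U : evenly_covered U -> orbit_atlas G (quotient_chart U).
Proof.
move=> eU; have [oU _] := eU.
have imgE : chart_img (quotient_chart U) = U.
  apply/seteqP; split=> [_ [_ [z Uz <-] <-]|z Uz]; first by rewrite quotient_chartK.
  by exists (pi z); [exists z|rewrite quotient_chartK].
split; last by [].
split; rewrite ?imgE //.
- exact: orbit_proj_open.
- apply: continuous_in_subspaceT => _ /set_mem[z Uz <-].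
  apply: (open_map_continuous_at orbit_proj_open).
  have qK w : U w -> (chart_map (quotient_chart U) \o pi) w = w.
    exact: quotient_chartK.
  move=> W; rewrite qK // => zW.
  have zU : nbhs z U by exact: open_nbhs_nbhs.
  by apply: filterS2 zW zU => w Ww Uw; rewrite -[w]qK // in Ww.
- exact/continuous_subspaceT/orbit_proj_continuous.
- by move=> _ /set_mem[z Uz <-]; rewrite quotient_chartK.
Qed.

End SmallCharts.

Lemma orbit_space_manifold : acts_freely G -> acts_properly_discontinuously G ->
  complex_manifold (orbit_atlas G).
Proof.
move=> frG pdG; split.
- exact: orbit_space_hausdorff.
- exact: orbit_space_second_countable.
- by move=> c [].
- move=> x; have [U eU Ux] := evenly_covered_nbhs (repr x) frG pdG.
  exists (quotient_chart U); first exact: quotient_chart_atlas.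
  by exists (repr x) => //; exact: orbit_proj_repr.
- move=> c d x hc hd cx dx.
  have dd : differentiable (chart_map d \o pi) (chart_map c x).
    by apply: orbit_chart_proj_differentiable; rewrite ?orbit_chart_section.
  apply: near_eq_differentiable dd.
  have cz : chart_img c (chart_map c x) by exists x.
  by apply: filterS (orbit_chart_inv_near hc cz) => w /= ->.
Qed.

(** Holomorphy of a map defined on the quotient is tested on its composition
    with the projection: the projection is open, and inverses of charts agree
    locally with it. *)
Lemma orbit_holomorphic_on k (N : topologicalType) (B : set (chart R k N))
    (D : set (orbit_space G)) (f : orbit_space G -> N) :
  open D ->
  (forall z, D (pi z) -> {for z, continuous (f \o pi)}) ->
  (forall d z, B d -> D (pi z) -> chart_dom d (f (pi z)) ->
    differentiable (chart_map d \o f \o pi) z) ->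
  holomorphic_on (orbit_atlas G) B D f.
Proof.
move=> oD cf df; split=> //.
  apply: continuous_in_subspaceT => x /set_mem; rewrite -(orbit_proj_repr x) => Dx.
  exact: open_map_continuous_at orbit_proj_open (cf _ Dx).
move=> c d x hc hd Dx cx dx.
have dd : differentiable (chart_map d \o f \o pi) (chart_map c x).
  by apply: df; rewrite ?orbit_chart_section.
apply: near_eq_differentiable dd.
have cz : chart_img c (chart_map c x) by exists x.
by apply: filterS (orbit_chart_inv_near hc cz) => w /= ->.
Qed.

End Orbits.

Lemma equivariant_holomorphic_on (R : realType) m n (G : groupClosed (aut R m))
    (H : groupClosed (aut R n)) (F : 'cV[C R]_m -> 'cV[C R]_n)
    (f : orbit_space G -> orbit_space H) :
  holomorphic F -> f \o orbit_proj G =1 orbit_proj H \o F ->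
  holomorphic_on (orbit_atlas G) (orbit_atlas H) setT f.
Proof.
move=> hF /funext fE; apply: orbit_holomorphic_on; first exact: openT.
  move=> z _; rewrite fE; apply: continuous_comp.
    exact: holomorphic_continuous.
  exact: orbit_proj_continuous.
move=> d z hd _ dz; rewrite -compA fE compA.
have fz : f (orbit_proj G z) = orbit_proj H (F z) := congr1 (@^~ z) fE.
apply: differentiable_comp => //.
by apply: orbit_chart_proj_differentiable => //; rewrite -fz.
Qed.

(** * The flat bundle of a linear representation *)

Section FlatBundle.
Variables (R : realType) (n r : nat) (Gamma : groupClosed (aut R n)).
Variable lambda : aut R n -> 'M[C R]_r.
Hypothesis lambda_GL : forall g, g \in Gamma -> lambda g \in unitmx.
Hypothesis lambda_morph : {in Gamma &, forall g h,
  lambda (g * h)%g = lambda g *m lambda h}.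

Lemma lambda1 : lambda 1%g = 1%:M.
Proof.
have G1 : 1%g \in Gamma by exact: gpred1.
have := lambda_morph G1 G1; rewrite mulg1.
move=> /(congr1 (mulmx (invmx (lambda 1%g)))).
by rewrite mulKmx ?lambda_GL // mulVmx ?lambda_GL.
Qed.

(** The lifted group is described by a relation because [lambda g] is known
    to be invertible only for [g] in [Gamma]. *)
Definition lifts (g : aut R n) (h : aut R (n + r)) :=
  forall p, h p = col_mx (g (usubmx p)) (lambda g *m dsubmx p).

Lemma lift_exists g : g \in Gamma -> exists h, lifts g h.
Proof.
move=> gG; pose f p := col_mx (g (usubmx p)) (lambda g *m dsubmx p).
pose f' p := col_mx (aut_finv g (usubmx p)) (invmx (lambda g) *m dsubmx p).
have fK : cancel f f'.
  move=> p; rewrite /f' col_mxKu col_mxKd aut_funK mulKmx ?lambda_GL //.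
  exact: vsubmxK.
have f'K : cancel f' f.
  move=> p; rewrite /f col_mxKu col_mxKd aut_finvK mulKVmx ?lambda_GL //.
  exact: vsubmxK.
have hol (a : 'cV[C R]_n -> 'cV[C R]_n) (M : 'M[C R]_r) : holomorphic a -> holomorphic
    (fun p : 'cV[C R]_(n + r) => col_mx (a (usubmx p)) (M *m dsubmx p)).
  move=> ha p; apply: differentiable_col_mx.
    by apply: differentiable_comp => //; exact: differentiable_usubmx.
  apply: (@differentiable_comp _ _ _ _ dsubmx (mulmx M)).
    exact: differentiable_dsubmx.
  exact: differentiable_mulmx.
by exists (Aut fK f'K (hol _ _ (aut_holo g)) (hol _ _ (aut_finv_holo g))).
Qed.

Definition lift_pred : {pred aut R (n + r)} :=
  fun h => `[< exists2 g, g \in Gamma & lifts g h >].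

Lemma lift_pred1 : 1%g \in lift_pred.
Proof.
apply/asboolP; exists 1%g; first exact: gpred1.
by move=> p; rewrite lambda1 mul1mx [RHS]vsubmxK.
Qed.

Lemma lift_predM : mulg_closed lift_pred.
Proof.
move=> h h' /asboolP[g gG gh] /asboolP[g' g'G gh']; apply/asboolP.
exists (g * g')%g; first exact: gpredM.
move=> p; rewrite lambda_morph // -mulmxA.
by have -> : (h * h')%g p = h (h' p) by []; rewrite gh gh' col_mxKu col_mxKd.
Qed.

Lemma lift_predV : invg_closed lift_pred.
Proof.
move=> h /asboolP[g gG gh]; apply/asboolP.
have g'G : (g^-1)%g \in Gamma by rewrite gpredV.
exists (g^-1)%g => // p; have [h' gh'] := lift_exists g'G.
rewrite -gh' -[in RHS](aut_finvK h p) gh'; set q := aut_finv h p.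
rewrite gh col_mxKu col_mxKd mulmxA -lambda_morph // mulVg lambda1 mul1mx.
by rewrite -[LHS]vsubmxK; congr col_mx; apply/esym; exact: aut_funK.
Qed.

Definition lift_group : groupClosed (aut R (n + r)) :=
  HB.pack lift_pred (isInvClosed.Build _ lift_pred lift_predV)
    (isMul1Closed.Build _ lift_pred lift_pred1)
    (isMulClosed.Build _ lift_pred lift_predM).

Local Notation pi := (orbit_proj Gamma).
Local Notation piE := (orbit_proj lift_group).

Lemma lift_projP z v w u : piE (col_mx z v) = piE (col_mx w u) <->
  exists2 g : aut R n, g \in Gamma & g z = w /\ lambda g *m v = u.
Proof.
rewrite orbit_projP; split=> [[h /asboolP[g gG gh]]|[g gG [gz gv]]].
  by rewrite gh col_mxKu col_mxKd => /eq_col_mx; exists g.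
have [h gh] := lift_exists gG; exists h; first by apply/asboolP; exists g.
by rewrite gh col_mxKu col_mxKd gz gv.
Qed.

Lemma lift_proj_act (g : aut R n) p : g \in Gamma ->
  piE (col_mx (g (usubmx p)) (lambda g *m dsubmx p)) = piE p.
Proof. by move=> gG; rewrite -[in RHS](vsubmxK p); apply/esym/lift_projP; exists g. Qed.

Definition bundle_proj (e : orbit_space lift_group) : orbit_space Gamma :=
  pi (usubmx (repr e)).

Lemma bundle_projE p : bundle_proj (piE p) = pi (usubmx p).
Proof.
rewrite /bundle_proj; move: (orbit_proj_repr (piE p)); move: (repr (piE p)) => q.
rewrite -{1}(vsubmxK q) -{1}(vsubmxK p) => /lift_projP[g gG [<- _]].
by rewrite orbit_proj_act.
Qed.

(** Every fibre is a copy of C^r: a point of the fibre over [x] is the orbit of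
    a unique [(repr x, v)], the action being free. *)
Definition bundle_incl (x : orbit_space Gamma) (v : 'cV[C R]_r) :
  orbit_space lift_group := piE (col_mx (repr x) v).

Hypothesis frG : acts_freely Gamma.
Hypothesis pdG : acts_properly_discontinuously Gamma.

Lemma lift_projI z v u : piE (col_mx z v) = piE (col_mx z u) -> v = u.
Proof.
move=> /lift_projP[g gG [/(frG gG) -> <-]].
by rewrite lambda1 mul1mx.
Qed.

Lemma lift_free : acts_freely lift_group.
Proof.
move=> h p /asboolP[g gG gh]; rewrite gh => /(congr1 usubmx).
rewrite col_mxKu => /(frG gG) g1; apply: aut_eqP => q.
by rewrite gh g1 lambda1 mul1mx [LHS]vsubmxK.
Qed.

(** If the lift of [g] carries [K] to a set meeting [K], then [g] does the same
    for the first projection of [K], which is compact. *)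
Lemma lift_properly_discontinuous : acts_properly_discontinuously lift_group.
Proof.
move=> K cK; have cuK : compact (usubmx @` K : set 'cV[C R]_n).
  apply: continuous_compact => //; apply: continuous_subspaceT => p.
  exact/differentiable_continuous/differentiable_usubmx.
have /choice[l lE] : forall g : aut R n, exists h : aut R (n + r),
    g \in Gamma -> lifts g h.
  move=> g; have [gG|gG] := boolP (g \in Gamma); last by exists 1%g.
  by have [h gh] := lift_exists gG; exists h.
apply: sub_finite_set (finite_image l (pdG cuK)).
move=> h [/asboolP[g gG gh] [_ [[p Kp <-] Khp]]].
exists g; last by apply: aut_eqP => q; rewrite (lE _ gG) gh.
split=> //; exists (g (usubmx p)); split.
  by exists (usubmx p) => //; exists p.
by exists (h p) => //; rewrite gh col_mxKu.
Qed.

Lemma bundle_manifold : complex_manifold (orbit_atlas lift_group).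
Proof.
exact: orbit_space_manifold lift_free lift_properly_discontinuous.
Qed.

Lemma bundle_proj_holomorphic :
  holomorphic_on (orbit_atlas lift_group) (orbit_atlas Gamma) setT bundle_proj.
Proof.
apply: (equivariant_holomorphic_on (F := usubmx)); last exact: bundle_projE.
by move=> p; exact: differentiable_usubmx.
Qed.

Lemma bundle_incl_inj x : injective (bundle_incl x).
Proof. by move=> v u /lift_projI. Qed.

Lemma bundle_incl_range x : range (bundle_incl x) = bundle_proj @^-1` [set x].
Proof.
apply/seteqP; split=> [_ [v _ <-]|e /= ex].
  by rewrite /= bundle_projE col_mxKu orbit_proj_repr.
have /orbit_projP[g gG gz] : pi (usubmx (repr e)) = pi (repr x).
  by rewrite orbit_proj_repr.
exists (lambda g *m dsubmx (repr e)) => //.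
by rewrite /bundle_incl -gz lift_proj_act // orbit_proj_repr.
Qed.

Section Trivialisation.
Variable c : chart R n (orbit_space Gamma).
Hypothesis hc : orbit_atlas Gamma c.

(** Over the domain of a chart [c] of the base, each point of the bundle has a
    unique representative [(w, v)] with [w] in the image of [c]. Its second
    component is the fibre coordinate. *)
Definition fibre_coord (e : orbit_space lift_group) : 'cV[C R]_r :=
  xget 0 [set v | piE (col_mx (chart_map c (bundle_proj e)) v) = e].

Definition inverse_triv (p : orbit_space Gamma * 'cV[C R]_r) :=
  piE (col_mx (chart_map c p.1) p.2).

Lemma fibre_coordE w v : chart_img c w -> fibre_coord (piE (col_mx w v)) = v.
Proof.
move=> /(orbit_chart_retract hc)[cw cwK]; rewrite /fibre_coord.
rewrite bundle_projE col_mxKu cwK.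
case: xgetP => [u _ /lift_projI //|nv]; by case: (nv v).
Qed.

(** Upstairs, the fibre coordinate is locally [(z, v) |-> lambda_g v] where [g]
    is the element moving [z] into the image of the chart. So it is holomorphic,
    and linear in [v]. *)
Lemma fibre_coord_near p : chart_dom c (pi (usubmx p)) ->
  exists2 g : aut R n, g \in Gamma & g (usubmx p) = chart_map c (pi (usubmx p)) /\
    \forall q \near p, fibre_coord (piE q) = lambda g *m dsubmx q.
Proof.
move=> cp; have [g gG [gp gE]] := orbit_chart_proj_near hc cp.
exists g => //; split=> //.
have := differentiable_continuous (differentiable_usubmx p) gE.
apply: (@filterS _ (nbhs p)) => q /= [cq qE].
rewrite -(lift_proj_act q gG) fibre_coordE //.
by exists (pi (usubmx q)).
Qed.

Lemma fibre_coord_differentiable p : chart_dom c (pi (usubmx p)) ->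
  differentiable (fibre_coord \o piE) p.
Proof.
move=> /fibre_coord_near[g gG [_ gE]].
have d : differentiable (mulmx (lambda g) \o @dsubmx (C R) n r 1) p.
  apply: differentiable_comp; first exact: differentiable_dsubmx.
  exact: differentiable_mulmx.
apply: near_eq_differentiable d.
by apply: filterS gE => q /= ->.
Qed.

Let triv e := (bundle_proj e, fibre_coord e).

Lemma trivK : {in bundle_proj @^-1` chart_dom c, cancel triv inverse_triv}.
Proof.
move=> e /set_mem; rewrite -(orbit_proj_repr e); move: (repr e) => p /=.
rewrite bundle_projE => /(fibre_coord_near)[g gG [gp /nbhs_singleton gE]].
by rewrite /inverse_triv /= bundle_projE gE -gp lift_proj_act.
Qed.

Lemma inverse_trivK : {in chart_dom c `*` setT, cancel inverse_triv triv}.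
Proof.
move=> [x v] /set_mem[/= cx _]; rewrite /inverse_triv /triv /=.
rewrite bundle_projE col_mxKu orbit_chart_section // fibre_coordE //.
by exists x.
Qed.

Lemma triv_holomorphic : holomorphic_on (orbit_atlas lift_group)
  (prod_atlas (orbit_atlas Gamma) (@std_atlas R r))
  (bundle_proj @^-1` chart_dom c) triv.
Proof.
have cproj p : {for p, continuous (bundle_proj \o piE)}.
  have -> : bundle_proj \o piE = pi \o usubmx by exact/funext/bundle_projE.
  apply: continuous_comp; last exact: orbit_proj_continuous.
  exact/differentiable_continuous/differentiable_usubmx.
apply: orbit_holomorphic_on.
- have [[oc _ _ _ _] _] := hc.
  have cb : continuous bundle_proj.
    move=> e; rewrite -(orbit_proj_repr e).
    exact: open_map_continuous_at (@orbit_proj_open _ _ lift_group) (cproj _).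
  by move/continuousP: cb; apply.
- move=> p /=; rewrite bundle_projE => cp.
  exact: (cvg_pair (cproj p) (differentiable_continuous (fibre_coord_differentiable cp))).
- move=> _ p [d hd [_ -> <-]] /=; rewrite bundle_projE => cp [dp _].
  apply: differentiable_col_mx; last exact: fibre_coord_differentiable.
  have -> : (fun q => chart_map d (bundle_proj (piE q))) =
      (chart_map d \o pi) \o usubmx.
    by apply/funext => q; rewrite bundle_projE.
  apply: differentiable_comp; first exact: differentiable_usubmx.
  exact: orbit_chart_proj_differentiable.
Qed.

Lemma inverse_triv_holomorphic : holomorphic_on
  (prod_atlas (orbit_atlas Gamma) (@std_atlas R r)) (orbit_atlas lift_group)
  (chart_dom c `*` setT) inverse_triv.
Proof.
have [[oc _ _ _ _] _] := hc.
split.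
- have cf : continuous (@fst (orbit_space Gamma) 'cV[C R]_r) by move=> ?; exact: cvg_fst.
  by rewrite setXT; move/continuousP: cf; apply.
- apply: continuous_in_subspaceT => -[x v] /set_mem[/= cx _].
  have cm : {for x, continuous (chart_map c)}.
    rewrite -(orbit_proj_repr x) in cx *.
    apply: (open_map_continuous_at (@orbit_proj_open _ _ Gamma)).
    exact/differentiable_continuous/orbit_chart_proj_differentiable.
  apply: continuous_comp; last exact: orbit_proj_continuous.
  apply: continuous_col_mx; last exact: cvg_snd.
  by apply: continuous_comp; [exact: cvg_fst|exact: cm].
- move=> _ d [x v] [c' hc' [_ -> <-]] hd [/= cx _] [/= c'x _] dx.
  apply: (@differentiable_comp _ _ _ _
    (fun p => col_mx (chart_map c (chart_inv c' (usubmx p))) (dsubmx p))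
    (chart_map d \o piE)).
    apply: differentiable_col_mx; last exact: differentiable_dsubmx.
    apply: (@differentiable_comp _ _ _ _ usubmx (chart_map c \o chart_inv c')).
      exact: differentiable_usubmx.
    rewrite col_mxKu.
    have [_ _ _ _ tr] := orbit_space_manifold frG pdG.
    exact: tr.
  apply: orbit_chart_proj_differentiable => //.
  rewrite col_mxKu col_mxKd; move: dx; rewrite /inverse_triv /=.
  by have [[_ _ _ _ ->]] := hc'; rewrite ?inE.
Qed.

Lemma fibre_coord_linear x : chart_dom c x -> linear (fibre_coord \o bundle_incl x).
Proof.
move=> cx.
have cz : chart_dom c (pi (repr x)) by rewrite orbit_proj_repr.
have [g gG [gz gE]] := orbit_chart_proj_near hc cz.
have E v : fibre_coord (bundle_incl x v) = lambda g *m v.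
  have := lift_proj_act (col_mx (repr x) v) gG; rewrite col_mxKu col_mxKd.
  by rewrite /bundle_incl => <-; apply: fibre_coordE; rewrite gz; exists (pi (repr x)).
by move=> a u v /=; rewrite !E linearP.
Qed.

End Trivialisation.

Lemma bundle_local_triv (x0 : orbit_space Gamma) :
  exists U : set (orbit_space Gamma),
  exists (tau : orbit_space lift_group -> 'cV[C R]_r)
    (theta : orbit_space Gamma * 'cV[C R]_r -> orbit_space lift_group),
  let triv e := (bundle_proj e, tau e) in
  [/\ open U /\ U x0,
      holomorphic_on (orbit_atlas lift_group)
        (prod_atlas (orbit_atlas Gamma) (@std_atlas R r)) (bundle_proj @^-1` U) triv,
      holomorphic_on (prod_atlas (orbit_atlas Gamma) (@std_atlas R r))
        (orbit_atlas lift_group) (U `*` setT) theta,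
      {in bundle_proj @^-1` U, cancel triv theta} /\
      {in U `*` setT, cancel theta triv} &
      forall x, U x -> linear (tau \o bundle_incl x)].
Proof.
have [_ _ _ /(_ x0)[c hc cx0] _] := orbit_space_manifold frG pdG.
exists (chart_dom c), (fibre_coord c), (inverse_triv c); split.
- by split=> //; have [[]] := hc.
- exact: triv_holomorphic.
- exact: inverse_triv_holomorphic.
- by split; [exact: trivK|exact: inverse_trivK].
- exact: fibre_coord_linear.
Qed.

Definition flat_bundle : vector_bundle (orbit_atlas Gamma) r :=
  @VectorBundle R n (orbit_space Gamma) (orbit_atlas Gamma) r
    (orbit_space lift_group) (orbit_atlas lift_group) bundle_manifold
    bundle_proj bundle_proj_holomorphic (fun=> 'cV[C R]_r) bundle_incl
    bundle_incl_inj bundle_incl_range bundle_local_triv.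

End FlatBundle.

(** * The spray *)

Section Spray.
Variables (R : realType) (n : nat) (Gamma : groupClosed (aut R n)).

Lemma linear_chart_inv r (c : chart R r 'cV[C R]_r) :
  linear_atlas c -> linear (chart_inv c).
Proof.
move=> [_ lc cK cK'] a u v; apply: (can_inj cK).
by rewrite lc !cK'.
Qed.

(** In charts, the map is [g \o f] up to a linear change of coordinates, with
    [g] in the group; being a biholomorphism, it has a surjective
    differential. *)
Lemma orbit_proj_aut_submersion (f : aut R n) :
  submersion_at (@linear_atlas R n 'cV[C R]_n) (orbit_atlas Gamma)
    (orbit_proj Gamma \o f) 0.
Proof.
move=> c d lc hd _ d0 /=.
have lci := linear_chart_inv lc; have [_ lcm cK cK'] := lc.
have [g gG [_ gE]] := orbit_chart_proj_near hd d0.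
(* [h \o chart_inv c] is the local expression of the map, with inverse [k]. *)
pose h := aut_mul g f; pose k := chart_map c \o aut_finv h.
have kK : cancel k (h \o chart_inv c).
  by move=> w; rewrite /k /= cK; exact: (aut_finvK h).
have c0 : chart_inv c (chart_map c 0) = 0 by rewrite cK.
have kh : k (h 0) = chart_map c 0 := congr1 (chart_map c) (aut_funK h 0).
have dk : differentiable k (h 0).
  apply: differentiable_comp; first exact: aut_finv_holo.
  exact: mx_linear_differentiable.
have dci : differentiable (chart_inv c) (chart_map c 0).
  exact: mx_linear_differentiable.
have dh : differentiable (h \o chart_inv c) (chart_map c 0).
  exact: differentiable_comp dci (aut_holo h _).
have near_h : \forall w \near chart_map c 0, (h \o chart_inv c) w =
    (chart_map d \o (orbit_proj Gamma \o f) \o chart_inv c) w.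
  have cont : {for chart_map c 0, continuous (f \o chart_inv c)}.
    apply: continuous_comp; first exact: differentiable_continuous.
    exact: aut_continuous.
  have := cont _; rewrite /continuous_at /= c0 => /(_ _ gE).
  by apply: (@filterS _ (nbhs (chart_map c 0))) => w /= [_ ->].
have [dg val_d] := near_eq_is_diff near_h (differentiableP dh).
split; first exact: dg.
rewrite val_d -kh; apply: diff_right_inverse_surj kK dk _.
by rewrite kh.
Qed.

End Spray.

Theorem proposition1 (R : realType) (n : nat)
  (Gamma : groupClosed (aut R n))
  (Gamma_discrete : discrete_subset [set` Gamma])
  (Gamma_free : acts_freely Gamma)
  (Gamma_pd : acts_properly_discontinuously Gamma)
  (sigma : 'cV[C R]_n -> aut R n)
  (sigma_holo : holomorphic
     (fun p : 'cV[C R]_n * 'cV[C R]_n => sigma p.1 p.2))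
  (sigma0 : forall z, sigma z 0 = z)
  (lambda : aut R n -> 'M[C R]_n)
  (lambda_GL : forall g, g \in Gamma -> lambda g \in unitmx)
  (lambda_morph : {in Gamma &, forall g h,
     lambda (g * h)%g = lambda g *m lambda h})
  (sigma_lambda : forall z g, g \in Gamma ->
     sigma (g z) \o mulmx (lambda g) \o (sigma z)^-1%g = g) :
  elliptic_manifold (orbit_atlas Gamma).
Proof.
have sigma_equiv g z v : g \in Gamma ->
    sigma (g z) (lambda g *m v) = g (sigma z v).
  move=> gG; have zK : (sigma z)^-1%g (sigma z v) = v by exact: aut_funK.
  have /(congr1 (fun f : _ -> _ => f (sigma z v))) <- := sigma_lambda z g gG.
  by rewrite -[in LHS]zK.
(* The spray upstairs; by [sigma_equiv] it is equivariant for the lifted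
   action. *)
pose F (p : 'cV[C R]_(n + n)) := sigma (usubmx p) (dsubmx p).
pose E := flat_bundle lambda_GL lambda_morph Gamma_free Gamma_pd.
pose s (e : vb_total E) : orbit_space Gamma := orbit_proj Gamma (F (repr e)).
have sE p : s (orbit_proj (lift_group lambda_GL lambda_morph) p) =
    orbit_proj Gamma (F p).
  rewrite /s; set q := repr _.
  have : orbit_proj (lift_group lambda_GL lambda_morph) q =
      orbit_proj (lift_group lambda_GL lambda_morph) p by exact: orbit_proj_repr.
  rewrite -{1}(vsubmxK q) -{1}(vsubmxK p) => /lift_projP[g gG [gz gv]].
  by rewrite /F -gz -gv sigma_equiv // (orbit_proj_act _ gG).
have hF : holomorphic F.
  move=> p; have := differentiable_pair (differentiable_usubmx p)
    (differentiable_dsubmx p).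
  by move=> /differentiable_comp /(_ (sigma_holo _)).
split; first exact: orbit_space_manifold.
exists n, E, s; split; first exact: (equivariant_holomorphic_on hF sE).
move=> x; pose incl := @vb_incl _ _ _ _ _ E x.
have sx v : s (incl v) = orbit_proj Gamma (sigma (repr x) v).
  by rewrite [LHS]sE /F col_mxKu col_mxKd.
split; first by rewrite sx sigma0 orbit_proj_repr.
have -> : s \o incl = orbit_proj Gamma \o sigma (repr x) by exact/funext.
exact: orbit_proj_aut_submersion.
Qed.
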